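(* Let $H$ be a graph. The class of $H$-free graphs is bounded-apex-bipartite if and only if $H$ is an induced subgraph of $K_2$.
   Context: All graphs are finite and simple. $K_2$ is the complete graph on two vertices. ''Induced subgraph of $X$'' means isomorphic to $X[S]$ for some $S\subseteq V(X)$. A graph is $H$-free if none of its induced subgraphs is isomorphic to $H$. A class of graphs is bounded-apex-bipartite if there is a constant $c\in\mathbb{N}$ such that every graph $G$ in the class has a set $S\subseteq V(G)$ with $|S|\le c$ such that $G-S$ is bipartite. *)

(* Defs.v *)
From HB Require Import structures.
From mathcomp Require Import all_boot.
Set Implicit Arguments.
Unset Strict Implicit.
Unset Printing Implicit Defensive.

(* The vertex set may be empty: the null graph is a graph. *)
Record sgraph := SGraph {
  vertex :> finType;
  edge : rel vertex;
  edge_sym : symmetric edge;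
  edge_irrefl : irreflexive edge
}.

Section Induced.
Variables (G : sgraph) (S : {set G}).

Definition induced_rel : rel {x : G | x \in S} :=
  fun x y => edge (val x) (val y).

Lemma induced_sym : symmetric induced_rel.
Proof. by move=> x y; apply: edge_sym. Qed.

Lemma induced_irrefl : irreflexive induced_rel.
Proof. by move=> x; apply: edge_irrefl. Qed.

Definition induced : sgraph := SGraph induced_sym induced_irrefl.

End Induced.

Definition isomorphic (G H : sgraph) : Prop :=
  exists f : G -> H,
    bijective f /\ forall x y : G, edge (f x) (f y) = edge x y.

Definition induced_subgraph (H G : sgraph) : Prop :=
  exists S : {set G}, isomorphic H (induced S).

Definition free (H G : sgraph) : Prop := ~ induced_subgraph H G.

Definition stable (G : sgraph) (A : {set G}) : Prop :=
  forall x y : G, x \in A -> y \in A -> ~~ edge x y.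

Definition bipartite (G : sgraph) : Prop :=
  exists A : {set G}, stable A /\ stable (~: A).

Definition delete (G : sgraph) (S : {set G}) : sgraph := induced (~: S).

Definition bounded_apex_bipartite (C : sgraph -> Prop) : Prop :=
  exists c : nat, forall G : sgraph, C G ->
    exists S : {set G}, #|S| <= c /\ bipartite (delete S).

Lemma complete_sym n : symmetric (fun x y : 'I_n => x != y).
Proof. by move=> x y; rewrite eq_sym. Qed.

Lemma complete_irrefl n : irreflexive (fun x y : 'I_n => x != y).
Proof. by move=> x; rewrite eqxx. Qed.

Definition complete (n : nat) : sgraph :=
  SGraph (@complete_sym n) (@complete_irrefl n).

(* Main.v *)
Require Import Defs.
From mathcomp Require Import all_boot.

(** For the forward direction, two families of graphs need arbitrarily many
    vertex deletions to become bipartite: the complete graphs, since at most two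
    vertices of a clique can survive, and the disjoint unions of pentagons, since
    every copy must lose a vertex.  If deleting [c] vertices suffices for every
    [H]-free graph, then large members of neither family are [H]-free, so [H]
    embeds as an induced subgraph in a graph of each kind
    ([complete_not_free], [pentagons_not_free]).  The first embedding makes [H]
    complete; the second makes [H] triangle-free, because pentagons have no
    triangle.  A complete triangle-free graph has at most two vertices.

    Conversely, if [H] is an induced subgraph of [complete 2], then an edge of [G]
    would give an induced copy of [complete 2], hence of [H], in [G].  Thus
    [H]-free graphs have no edges and are bipartite without any deletion. *)

(** Working with embeddings rather than vertex subsets makes composition of
    inclusions immediate and hides the subtypes in [induced]. *)
Lemma induced_subgraphP (H G : sgraph) :
  induced_subgraph H G <->
  exists f : H -> G, injective f /\ forall x y, edge (f x) (f y) = edge x y.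
Proof.
split=> [[S [f [bij_f edge_f]]]|[f [inj_f edge_f]]].
  exists (fun x => val (f x)); split; last exact: edge_f.
  by move=> x y /val_inj; apply: bij_inj.
pose S := [set y in codom f].
have fS x : f x \in S by rewrite inE codom_f.
pose g x : induced S := exist (fun y => y \in S) (f x) (fS x).
exists S, g; split; last by move=> x y; apply: edge_f.
apply: inj_card_bij => [x y [/inj_f] //|].
rewrite card_sig -(card_codom inj_f).
by apply/subset_leq_card/subsetP=> y; rewrite !inE.
Qed.

Lemma induced_subgraph_trans (F G H : sgraph) :
  induced_subgraph F G -> induced_subgraph G H -> induced_subgraph F H.
Proof.
move=> /induced_subgraphP[f [inj_f edge_f]] /induced_subgraphP[g [inj_g edge_g]].
apply/induced_subgraphP; exists (g \o f); split; first exact: inj_comp.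
by move=> x y; rewrite /= edge_g edge_f.
Qed.

Lemma edge_induced_complete2 {G : sgraph} (x y : G) :
  edge x y -> induced_subgraph (complete 2) G.
Proof.
move=> exy; apply/induced_subgraphP.
have neq_xy : x != y by apply: contraTneq exy => ->; rewrite edge_irrefl.
exists (fun i : 'I_2 => if i == ord0 then x else y); split.
  move=> [[|[|//]] hi] [[|[|//]] hj] /= E; apply: val_inj => //=.
    by rewrite E eqxx in neq_xy.
  by rewrite E eqxx in neq_xy.
by move=> [[|[|//]] hi] [[|[|//]] hj]; rewrite /= ?edge_irrefl // edge_sym.
Qed.

(** The coloring is total on [G], with arbitrary values on [S], so that it can
    be used without constructing elements of the subtype [delete S]. *)
Lemma bipartite_delete_coloring {G : sgraph} {S : {set G}} :
  bipartite (delete S) ->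
  exists col : G -> bool,
    forall x y, x \notin S -> y \notin S -> edge x y -> col x != col y.
Proof.
move=> [A [stA stAc]].
exists (fun x => x \in [set val u | u in A]) => x y xS yS exy.
have xS' : x \in ~: S by rewrite inE.
have yS' : y \in ~: S by rewrite inE.
pose u : delete S := exist (fun z => z \in ~: S) x xS'.
pose v : delete S := exist (fun z => z \in ~: S) y yS'.
have euv : edge u v by [].
have memA (w : delete S) : (val w \in [set val u | u in A]) = (w \in A).
  by apply: mem_imset; apply: val_inj.
rewrite (memA u) (memA v).
apply/negP=> /eqP E; case uA: (u \in A) E => /esym vA.
  by move: (stA u v uA vA); rewrite euv.
by move: (stAc u v); rewrite !inE uA vA euv => /(_ isT isT).
Qed.

(** A proper coloring is injective on the surviving vertices of a clique, so at
    most two of them survive. *)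
Lemma complete_apex n (S : {set complete n}) :
  bipartite (delete S) -> n <= #|S| + 2.
Proof.
move=> /bipartite_delete_coloring[col colP].
rewrite -[n in n <= _]card_ord -(cardsC S) leq_add2l -card_bool.
rewrite -(@card_in_imset _ _ col) ?max_card // => x y; rewrite !inE => xS yS E.
by apply/eqP; apply: contraT => /(colP x y xS yS); rewrite E eqxx.
Qed.

Definition pentagon_rel : rel 'I_5 :=
  fun x y => (y == ordS x) || (x == ordS y).

Lemma pentagon_triangle_free {x y z} :
  pentagon_rel x y -> pentagon_rel y z -> ~~ pentagon_rel z x.
Proof.
by case: x y z => [[|[|[|[|[|//]]]]] ?] [[|[|[|[|[|//]]]]] ?] [[|[|[|[|[|//]]]]] ?].
Qed.

Lemma pentagon_not_2_colorable (col : 'I_5 -> bool) :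
  ~ forall x y, pentagon_rel x y -> col x != col y.
Proof.
move=> colP.
have step x : col (ordS x) = ~~ col x.
  move: (colP x (ordS x)); rewrite /pentagon_rel eqxx => /(_ isT).
  by case: (col (ordS x)); case: (col x).
(* Five color flips lead once around the cycle, back to the start. *)
have /(congr1 col) : ordS (ordS (ordS (ordS (ordS (@ord0 4))))) = ord0.
  exact: val_inj.
by rewrite !step; case: (col ord0).
Qed.

Section Pentagons.
Variable n : nat.

Definition pentagons_rel : rel ('I_n * 'I_5) :=
  fun u v => (u.1 == v.1) && pentagon_rel u.2 v.2.

Lemma pentagons_sym : symmetric pentagons_rel.
Proof. by move=> u v; rewrite /pentagons_rel /pentagon_rel eq_sym orbC. Qed.

Lemma pentagons_irrefl : irreflexive pentagons_rel.
Proof. by case=> i [[|[|[|[|[|//]]]]] ?]; rewrite /pentagons_rel /= andbF. Qed.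

Definition pentagons : sgraph := SGraph pentagons_sym pentagons_irrefl.

Lemma pentagons_triangle_free (u v w : pentagons) :
  edge u v -> edge v w -> ~~ edge w u.
Proof.
move=> /andP[_ uv] /andP[_ vw]; rewrite /= /pentagons_rel negb_and.
by rewrite (pentagon_triangle_free uv vw) orbT.
Qed.

(** A copy that [S] misses would be a 2-colored pentagon, so the projection of
    [S] to the set of copies is onto. *)
Lemma pentagons_apex (S : {set pentagons}) : bipartite (delete S) -> n <= #|S|.
Proof.
move=> /bipartite_delete_coloring[col colP]; rewrite leqNgt; apply/negP=> ltSn.
pose T : {set 'I_n} := [set u.1 | u : pentagons in S].
have ltTn : #|T| < n by apply: leq_ltn_trans ltSn; apply: leq_imset_card.
have [i iT] : exists i, i \in ~: T.
  apply/card_gt0P; move: ltTn.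
  by rewrite -[n in _ < n]card_ord -(cardsC T) -ltn_subLR // subnn.
have iS x : (i, x) \notin S.
  by move: iT; rewrite inE; apply: contra => ixS; apply/imsetP; exists (i, x).
apply: (@pentagon_not_2_colorable (fun x => col (i, x))) => x y exy.
by apply: colP => //; rewrite /edge /= /pentagons_rel /= eqxx.
Qed.

End Pentagons.

Lemma complete_not_free {H : sgraph} :
  bounded_apex_bipartite (free H) -> exists n, ~ free H (complete n).
Proof.
move=> [c apexP]; exists c.+3 => /apexP[S [leSc /complete_apex]].
by rewrite addn2 !ltnS leqNgt ltnS leSc.
Qed.

Lemma pentagons_not_free {H : sgraph} :
  bounded_apex_bipartite (free H) -> exists n, ~ free H (pentagons n).
Proof.
move=> [c apexP]; exists c.+1 => /apexP[S [leSc /pentagons_apex]].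
by rewrite ltnNge leSc.
Qed.

Lemma induced_complete_edge {H : sgraph} {n} :
  induced_subgraph H (complete n) -> forall x y : H, edge x y = (x != y).
Proof.
move=> /induced_subgraphP[f [inj_f edge_f]] x y.
by rewrite -edge_f /= (inj_eq inj_f).
Qed.

Lemma induced_complete {H : sgraph} {n} :
  (forall x y : H, edge x y = (x != y)) -> #|H| <= n ->
  induced_subgraph H (complete n).
Proof.
move=> edgeH leHn; apply/induced_subgraphP.
have inj_f : injective (fun x : H => widen_ord leHn (enum_rank x)).
  by move=> x y /(congr1 val) /= /ord_inj/enum_rank_inj.
exists (fun x => widen_ord leHn (enum_rank x)); split=> // x y.
by rewrite edgeH /= (inj_eq inj_f).
Qed.

Theorem theorem9p1 (H : sgraph) :
  bounded_apex_bipartite (free H) <-> induced_subgraph H (complete 2).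
Proof.
split=> [apexH|HK2].
  (* The embeddings are only available under a double negation, which the
     boolean conclusions about [H] absorb. *)
  have edgeH (x y : H) : edge x y = (x != y).
    have [n nfree] := complete_not_free apexH.
    apply/eqP; apply: contra_notT nfree => neq HKn.
    by rewrite (induced_complete_edge HKn) eqxx in neq.
  apply: (induced_complete edgeH).
  have [n nfree] := pentagons_not_free apexH.
  apply: contra_notT nfree; rewrite -ltnNge => /card_gt2P.
  move=> [x [y [z [_ [xy yz zx]]]]] /induced_subgraphP[f [_ edge_f]].
  have := @pentagons_triangle_free n (f x) (f y) (f z).
  by rewrite !edge_f !edgeH xy yz zx => /(_ isT isT).
exists 0 => G freeG; exists set0; split; first by rewrite cards0.
exists set0; split=> [x y|x y _ _]; first by rewrite inE.
apply/negP=> exy; apply: freeG.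
exact: induced_subgraph_trans HK2 (edge_induced_complete2 (val x) (val y) exy).
Qed.
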